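(* Let $I$ be a set. Every $I$-dimensional cylindric UVO-space $X$ is relationally homeomorphic to $\mathcal{S}_0(\mathcal{A}_0(X))$.
   Context: For a binary relation $R$ on $X$ and $U\subseteq X$, $R[U]=\{y:xRy\text{ for some }x\in U\}$. An orthoframe is a set $X$ with an irreflexive symmetric relation $\perp$; for $U\subseteq X$, $U^{\perp}=\{x:x\perp y\text{ for all }y\in U\}$, and $\mathcal{B}(X)=\{U\subseteq X:U=U^{\perp\perp}\}$. A monadic orthoframe $\langle X;\perp,R\rangle$ is an orthoframe with a reflexive transitive relation $R$ such that $R[R[\{x\}]^{\perp}]\subseteq R[\{x\}]^{\perp}$ for all $x\in X$. An $I$-dimensional cylindric orthoframe is $\langle X;\perp,(R_i)_{i\in I},(\Delta_{i,k})_{i,k\in I}\rangle$ such that for all $i,k,l\in I$: $\langle X;\perp,R_i\rangle$ is a monadic orthoframe; $R_i\circ R_k=R_k\circ R_i$; $\Delta_{i,k}\subseteq X$ with $\Delta_{i,k}=\Delta_{k,i}=\Delta_{i,k}^{\perp\perp}$ and $\Delta_{i,i}=X$; if $i\ne k$ and $l\neq k$, then $R_k[\Delta_{i,k}\cap\Delta_{k,l}]=\Delta_{i,l}$. For $U,V\in\mathcal{B}(X)$: $U\sqcup V=(U\cup V)^{\perp\perp}$ and $\exists_RU=R[U]^{\perp\perp}$. For a topological orthoframe $X$, $\mathcal{CO}(X)$ is the set of compact open subsets, $\mathcal{COB}(X)=\mathcal{CO}(X)\cap\mathcal{B}(X)$, and $\mathcal{COB}_X(x)=\{U\in\mathcal{COB}(X):x\in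 U\}$. A monadic UVO-space $\langle X;\perp,R,\tau\rangle$ satisfies: (1) $\langle X;\perp,R\rangle$ is a monadic orthoframe over a $T_0$-space; (2) $\mathcal{COB}(X)$ is a basis for $X$ and is closed under $\cap$ and ${}^{\perp}$; (3) every proper filter in $\mathcal{COB}(X)$ is of the form $\mathcal{COB}_X(x)$ for some $x\in X$; (4) if $x\perp y$, there is $U\in\mathcal{COB}(X)$ with $x\in U$ and $y\in U^{\perp}$; (5) $R[U]\in\mathcal{COB}(X)$ for $U\in\mathcal{COB}(X)$; (6) if not $xRy$, there is $U\in\mathcal{COB}(X)$ with $U=\exists_RV$ for some $V\in\mathcal{COB}_X(x)$ and $y\notin U$. Filters are non-empty. An $I$-dimensional cylindric UVO-space is $\langle X;\perp,(R_i)_{i\in I},(\Delta_{i,k})_{i,k\in I},\tau\rangle$ whose relational part is an $I$-dimensional cylindric orthoframe, such that $\langle X;\perp,R_i,\tau\rangle$ is a monadic UVO-space for each $i$, and $\Delta_{i,k}\in\mathcal{CO}(X)$ for all $i,k\in I$. $\mathcal{A}_0(X)=\langle\mathcal{COB}(X);\cap,\sqcup,{}^{\perp},\emptyset,X,(\exists_{R_i})_{i\in I},(\Delta_{i,k})_{i,k\in I}\rangle$. For an algebra $A=\langle A;\wedge,\vee,{}^\perp,0,1,(\exists_i)_{i\in I},(\delta_{i,k})_{i,k\in I}\rangle$ of this type, $\mathcal{S}_0(A)=\langle\mathfrak{F}(A);\perp,(R_i)_{i\in I},(\Delta_{i,k})_{i,k\in I},\tau(\beta)\rangle$, where $\mathfrak{F}(A)$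 is the set of non-empty proper filters of $A$; $x\perp y$ iff there is $a\in x$ with $a^{\perp}\in y$; $xR_iy$ iff $\{\exists_ia:a\in x\}\subseteq y$; $\Delta_{i,k}=\phi(\delta_{i,k})$; and $\tau(\beta)$ is the topology with basis $\{\phi(a):a\in A\}$, $\phi(a)=\{x\in\mathfrak{F}(A):a\in x\}$. A relational homeomorphism is a homeomorphism $f$ that is an isomorphism for the binary relations: $x\perp y\Leftrightarrow f(x)\perp f(y)$ and $xR_iy\Leftrightarrow f(x)R_if(y)$ for all $i\in I$.
   Formalization: For empty I the listed conditions put no constraint on the topology and the claim fails, so the space is then additionally required to satisfy the UVO-space conditions not involving R; for non-empty I nothing changes. *)

(* Defs.v *)
From HB Require Import structures.
From mathcomp Require Import all_boot all_classical topology.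

Set Implicit Arguments.
Unset Strict Implicit.
Unset Printing Implicit Defensive.

Local Open Scope classical_set_scope.

Section Relations.
Context {T : Type}.
Implicit Types (R S perp : T -> T -> Prop) (U V : set T).

Definition rel_image R U : set T := [set y | exists2 x, U x & R x y].

Definition rel_comp R S : T -> T -> Prop :=
  fun x z => exists2 y, R x y & S y z.

Definition polar perp U : set T := [set x | forall y, U y -> perp x y].

Definition biclosed perp : set (set T) :=
  [set U | U = polar perp (polar perp U)].

Definition bijoin perp U V : set T := polar perp (polar perp (U `|` V)).

Definition biexists perp R U : set T := polar perp (polar perp (rel_image R U)).

Record is_orthoframe perp : Prop := {
  perp_irrefl : forall x, ~ perp x x;
  perp_sym : forall x y, perp x y -> perp y x }.

Record is_monadic_orthoframe perp R : Prop := {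
  mof_orthoframe : is_orthoframe perp;
  mof_refl : forall x, R x x;
  mof_trans : forall x y z, R x y -> R y z -> R x z;
  mof_polar : forall x,
    rel_image R (polar perp (rel_image R [set x]))
      `<=` polar perp (rel_image R [set x]) }.

(* [perp] is required to be an orthoframe separately so that this is also
   imposed when [I] is empty. *)
Record is_cylindric_orthoframe (I : Type) perp (R : I -> T -> T -> Prop)
    (Delta : I -> I -> set T) : Prop := {
  cof_orthoframe : is_orthoframe perp;
  cof_monadic : forall i, is_monadic_orthoframe perp (R i);
  cof_comm : forall i k, rel_comp (R i) (R k) = rel_comp (R k) (R i);
  cof_diag_sym : forall i k, Delta i k = Delta k i;
  cof_diag_closed : forall i k, biclosed perp (Delta i k);
  cof_diag_refl : forall i, Delta i i = setT;
  cof_diag_image : forall i k l, i <> k -> l <> k ->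
    rel_image (R k) (Delta i k `&` Delta k l) = Delta i l }.

(* Non-empty proper filters of the meet-semilattice carried by the subset [L]
   of [T]. *)
Record is_proper_filter (L : set T) (le : T -> T -> Prop) (meet : T -> T -> T)
    (F : set T) : Prop := {
  pf_sub : F `<=` L;
  pf_nonempty : F !=set0;
  pf_up : forall a b, F a -> L b -> le a b -> F b;
  pf_meet : forall a b, F a -> F b -> F (meet a b);
  pf_proper : F <> L }.

End Relations.

Section UVO.
Context {X : topologicalType}.
Implicit Types (perp R : X -> X -> Prop).

Definition CO : set (set X) := [set U | compact U /\ open U].

Definition COB perp : set (set X) := CO `&` biclosed perp.

Definition COB_at perp (x : X) : set (set X) := [set U | COB perp U /\ U x].

(* The conditions on a monadic UVO-space that do not mention the relation. *)
Record is_UVO perp : Prop := {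
  uvo_orthoframe : is_orthoframe perp;
  uvo_T0 : kolmogorov_space X;
  uvo_basis : basis (COB perp);
  uvo_capI : forall U V, COB perp U -> COB perp V -> COB perp (U `&` V);
  uvo_polar : forall U, COB perp U -> COB perp (polar perp U);
  uvo_filter : forall F : set (set X),
    is_proper_filter (COB perp) (fun U V => U `<=` V) setI F ->
    exists x, F = COB_at perp x;
  uvo_perp : forall x y, perp x y ->
    exists2 U, COB perp U & U x /\ polar perp U y }.

Record is_monadic_UVO perp R : Prop := {
  muvo_uvo : is_UVO perp;
  muvo_frame : is_monadic_orthoframe perp R;
  muvo_image : forall U, COB perp U -> COB perp (rel_image R U);
  muvo_sep : forall x y, ~ R x y ->
    exists U, [/\ COB perp U,
                  exists2 V, COB_at perp x V & U = biexists perp R V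
                & ~ U y] }.

End UVO.

Record cylindric_space (I : Type) := CylindricSpace {
  cs_space :> topologicalType;
  cs_perp : cs_space -> cs_space -> Prop;
  cs_rel : I -> cs_space -> cs_space -> Prop;
  cs_diag : I -> I -> set cs_space }.

(* [cuvo_uvo] follows from [cuvo_monadic] unless [I] is empty; a 0-dimensional
   cylindric UVO-space is thus a UVO-space, rather than an orthoframe with an
   arbitrary topology. *)
Record is_cylindric_UVO (I : Type) (X : cylindric_space I) : Prop := {
  cuvo_frame : is_cylindric_orthoframe (@cs_perp I X) (@cs_rel I X)
                 (@cs_diag I X);
  cuvo_uvo : is_UVO (@cs_perp I X);
  cuvo_monadic : forall i, is_monadic_UVO (@cs_perp I X) (@cs_rel I X i);
  cuvo_diag : forall i k, CO (@cs_diag I X i k) }.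

(* The semilattice laws make [ca_le] an order, so that filters make sense, and
   make the sets [phi a] below a basis; no other law is needed for [S0]. *)
Record cylindric_algebra (I : Type) := CylindricAlgebra {
  ca_sort :> Type;
  ca_meet : ca_sort -> ca_sort -> ca_sort;
  ca_join : ca_sort -> ca_sort -> ca_sort;
  ca_compl : ca_sort -> ca_sort;
  ca_zero : ca_sort;
  ca_one : ca_sort;
  ca_exists : I -> ca_sort -> ca_sort;
  ca_diag : I -> I -> ca_sort;
  ca_meetA : associative ca_meet;
  ca_meetC : commutative ca_meet;
  ca_meetxx : idempotent_op ca_meet }.

Section A0.
Context (I : Type) (X : cylindric_space I) (hX : is_cylindric_UVO X).
Local Notation perp := (@cs_perp I X).
Local Notation B := (COB perp).

Lemma polar_setU (U V : set X) :
  polar perp (U `|` V) = polar perp U `&` polar perp V.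
Proof.
apply/seteqP; split=> x /= h; first by split=> y hy; apply: h; [left|right].
by case: h => hU hV y [/hU|/hV].
Qed.

Lemma COB0 : B set0.
Proof.
have irr := perp_irrefl (cof_orthoframe (cuvo_frame hX)).
split; first by split; [exact: compact0 | exact: open0].
apply/seteqP; split=> // x /= h; apply: (irr x); exact: h.
Qed.

Lemma COBT : B setT.
Proof.
have -> : setT = polar perp set0 by apply/seteqP; split=> [x _ y []|].
exact: uvo_polar (cuvo_uvo hX) _ COB0.
Qed.

Lemma COB_join U V : B U -> B V -> B (bijoin perp U V).
Proof.
have h := cuvo_uvo hX => hU hV; rewrite /bijoin polar_setU.
by apply: uvo_polar => //; apply: uvo_capI => //; apply: uvo_polar.
Qed.

Lemma COB_exists i U : B U -> B (biexists perp (@cs_rel I X i) U).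
Proof.
have h := cuvo_uvo hX => hU.
by do 2!apply: uvo_polar => //; exact: muvo_image (cuvo_monadic hX i) _ hU.
Qed.

Lemma COB_diag i k : B (@cs_diag I X i k).
Proof. by split; [exact: cuvo_diag|exact: cof_diag_closed (cuvo_frame hX) _ _]. Qed.

Definition COBt := {U : set X | B U}.

Lemma COBt_inj (U V : COBt) : sval U = sval V -> U = V.
Proof. exact: eq_sig_hprop. Qed.

Definition COBt_meet (U V : COBt) : COBt :=
  exist _ (sval U `&` sval V) (uvo_capI (cuvo_uvo hX) (svalP U) (svalP V)).
Definition COBt_join (U V : COBt) : COBt :=
  exist _ (bijoin perp (sval U) (sval V)) (COB_join (svalP U) (svalP V)).
Definition COBt_compl (U : COBt) : COBt :=
  exist _ (polar perp (sval U)) (uvo_polar (cuvo_uvo hX) (svalP U)).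
Definition COBt_exists i (U : COBt) : COBt :=
  exist _ (biexists perp (@cs_rel I X i) (sval U)) (COB_exists i (svalP U)).
Definition COBt_diag i k : COBt := exist _ (@cs_diag I X i k) (COB_diag i k).

Lemma COBt_meetA : associative COBt_meet.
Proof. by move=> U V W; apply: COBt_inj; rewrite /= setIA. Qed.
Lemma COBt_meetC : commutative COBt_meet.
Proof. by move=> U V; apply: COBt_inj; rewrite /= setIC. Qed.
Lemma COBt_meetxx : idempotent_op COBt_meet.
Proof. by move=> U; apply: COBt_inj; rewrite /= setIid. Qed.

Definition A0 : cylindric_algebra I := {|
  ca_sort := COBt;
  ca_meet := COBt_meet;
  ca_join := COBt_join;
  ca_compl := COBt_compl;
  ca_zero := exist _ set0 COB0;
  ca_one := exist _ setT COBT;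
  ca_exists := COBt_exists;
  ca_diag := COBt_diag;
  ca_meetA := COBt_meetA;
  ca_meetC := COBt_meetC;
  ca_meetxx := COBt_meetxx |}.

End A0.

Section S0.
Context (I : Type) (A : cylindric_algebra I).

Definition ca_le (a b : A) : Prop := ca_meet a b = a.

Definition pfilter : Type :=
  {F : set A | is_proper_filter setT ca_le (@ca_meet I A) F}.

HB.instance Definition _ := gen_eqMixin pfilter.
HB.instance Definition _ := gen_choiceMixin pfilter.

Definition phi (a : A) : set pfilter := [set x | sval x a].

Lemma phi_cover : \bigcup_(U in range phi) U = setT.
Proof.
apply/seteqP; split=> // x _; have [a xa] := pf_nonempty (svalP x).
by exists (phi a) => //; exists a.
Qed.

Lemma phi_join (U V : set pfilter) (x : pfilter) :
  range phi U -> range phi V -> U x -> V x ->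
  exists W, [/\ range phi W, W x & W `<=` U `&` V].
Proof.
move=> [a _ <-] [b _ <-] xa xb; exists (phi (ca_meet a b)); split.
- by exists (ca_meet a b).
- exact: pf_meet (svalP x) _ _ xa xb.
- move=> y yab; split; apply: (pf_up (svalP y) yab) => //; rewrite /ca_le.
  + by rewrite (ca_meetC a) -ca_meetA ca_meetxx.
  + by rewrite -ca_meetA ca_meetxx.
Qed.

HB.instance Definition _ := @isBaseTopological.Build pfilter
  (set pfilter) (range phi) id phi_cover phi_join.

Definition S0 : cylindric_space I := {|
  cs_space := pfilter;
  cs_perp := fun x y => exists2 a, sval x a & sval y (ca_compl a);
  cs_rel := fun i x y => [set ca_exists i a | a in sval x] `<=` sval y;
  cs_diag := fun i k => phi (ca_diag A i k) |}.

End S0.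

(* The binary relations are preserved; nothing is required of the diagonals. *)
Definition is_relational_homeomorphism (I : Type) (X Y : cylindric_space I)
    (f : X -> Y) : Prop :=
  [/\ exists g : Y -> X, [/\ cancel f g, cancel g f,
        continuous f & continuous g],
      forall x y, cs_perp x y <-> cs_perp (f x) (f y)
    & forall i x y, cs_rel i x y <-> cs_rel i (f x) (f y)].

Definition relationally_homeomorphic (I : Type) (X Y : cylindric_space I) : Prop :=
  exists f : X -> Y, is_relational_homeomorphism f.

(* Main.v *)
Require Import Defs.
From mathcomp Require Import all_boot all_classical topology.

(** A point [x] is sent to the filter of all compact open biclosed sets that
    contain it. These sets are a basis of a T0 topology, so they separate
    points, and the map is injective ([point_filter_inj]). Surjectivity
    ([point_filter_surj]) is the filter axiom of UVO-spaces: every proper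
    filter of compact open biclosed sets consists of all those around some point.
    Under this bijection the basic set [phi U] of filters corresponds to the
    basic set [U] of points, so the map and its inverse are both continuous.

    The relations between filters only see which sets contain the points. Two
    orthogonal points have orthogonal filters by the axiom that separates them
    by some [U] and its polar, and the converse is the definition of the polar
    ([point_filter_perp]). If [x] is related to [y], then so are their filters,
    because a set lies in its bipolar; the converse is the contrapositive of the
    axiom that separates unrelated points ([point_filter_rel]). *)

Set Implicit Arguments.
Unset Strict Implicit.
Unset Printing Implicit Defensive.

Local Open Scope classical_set_scope.

Lemma sub_polar2 (T : Type) (perp : T -> T -> Prop) (U : set T) :
  is_orthoframe perp -> U `<=` polar perp (polar perp U).
Proof. by move=> h x Ux y hy; apply: (perp_sym h); exact: hy. Qed.

Lemma continuous_basis (S T : topologicalType) (B : set (set T)) (f : S -> T) :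
  basis B -> (forall U, B U -> open (f @^-1` U)) -> continuous f.
Proof.
move=> [_ Bnbhs] h x V /Bnbhs [U [BU Ufx] UV].
apply: (filterS (P := f @^-1` U)); first by move=> y; exact: UV.
by apply: open_nbhs_nbhs; split; [exact: h|].
Qed.

Lemma phi_open (I : Type) (A : cylindric_algebra I) (a : A) :
  @open (S0 A) (phi a).
Proof.
exists [set phi a]; first by move=> _ ->; exists a.
by rewrite bigcup_set1.
Qed.

Lemma continuous_phi (I : Type) (A : cylindric_algebra I)
    (T : topologicalType) (f : T -> S0 A) :
  (forall a : A, open (f @^-1` phi a)) -> continuous f.
Proof.
(* The open sets of [S0 A] are by construction unions of subfamilies of
   [range phi]. *)
move=> h; apply/continuousP => _ [D Dphi <-].
rewrite preimage_bigcup; apply: bigcup_open => U /Dphi [a _ <-]; exact: h.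
Qed.

Section PointFilter.
Context (I : Type) (X : cylindric_space I) (hX : is_cylindric_UVO X).
Local Notation perp := (@cs_perp I X).
Local Notation A := (A0 hX).
Local Notation hU := (cuvo_uvo hX).

Lemma A0_leE (a b : A) : ca_le a b <-> sval a `<=` sval b.
Proof.
split; first by move=> /(congr1 sval) /= /setIidPl.
by move=> ab; apply: COBt_inj; exact/setIidPl.
Qed.

Lemma point_filter_proper (x : X) :
  is_proper_filter setT (@ca_le I A) (@ca_meet I A) [set a : A | sval a x].
Proof.
split=> //.
- by exists (ca_one A).
- by move=> a b xa _ /A0_leE; apply.
- (* The empty set is an element of the algebra that contains no point. *)
  move=> xT; have : [set a : A | sval a x] (ca_zero A) by rewrite xT.
  by [].
Qed.

Definition point_filter (x : X) : S0 A := exist _ _ (point_filter_proper x).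

Lemma point_filter_inj : injective point_filter.
Proof.
move=> x y /(congr1 sval) /= xy; apply: contrapT => /eqP.
have Bxy U : COB perp U -> U x <-> U y.
  move=> BU; have : [set a : A | sval a x] (exist _ U BU) =
    [set a : A | sval a y] (exist _ U BU) by rewrite xy.
  by move=> /= ->.
case: (uvo_basis hU) => _ Bnbhs /(uvo_T0 hU) [V []].
- by rewrite !inE => -[/Bnbhs [U [BU Ux] UV]]; apply; apply: UV; exact/(Bxy _ BU).
- by rewrite !inE => -[/Bnbhs [U [BU Uy] UV]]; apply; apply: UV; exact/(Bxy _ BU).
Qed.

(** The algebra consists of sets bundled with a proof, while the filter axiom of
    a UVO-space speaks of families of bare sets; the filter [F] is therefore
    transported to the family [G] of its underlying sets. *)
Lemma point_filter_surj (F : S0 A) : exists x, point_filter x = F.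
Proof.
pose G : set (set X) := [set U | exists2 a, sval F a & sval a = U].
have FG (a : A) : G (sval a) -> sval F a.
  by case=> b Fb /COBt_inj <-.
have pfG : is_proper_filter (COB perp) (fun U V => U `<=` V) setI G.
  have [_ [a0 Fa0] Fup Fmeet Fproper] := svalP F; split.
  - by move=> _ [a _ <-]; exact: svalP.
  - by exists (sval a0); exists a0.
  - move=> _ V [a Fa <-] BV aV; exists (exist _ V BV) => //.
    by apply: (Fup _ _ Fa) => //; exact/A0_leE.
  - move=> _ _ [a Fa <-] [b Fb <-]; exists (ca_meet a b) => //.
    exact: Fmeet.
  - move=> GB; apply: Fproper; apply/seteqP; split=> // a _.
    by apply: FG; rewrite GB; exact: svalP.
have [x Gx] := uvo_filter hU pfG; exists x.
apply: eq_sig_hprop; first by move=> *; exact: Prop_irrelevance.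
apply/seteqP; split=> a /=.
- by move=> ax; apply: FG; rewrite Gx; split => //; exact: svalP.
- move=> Fa; have : G (sval a) by exists a.
  by rewrite Gx => -[].
Qed.

Lemma point_filter_perp x y :
  perp x y <-> cs_perp (point_filter x) (point_filter y).
Proof.
split.
- by move=> /(uvo_perp hU) [U BU [Ux Uy]]; exists (exist _ U BU).
- by move=> [a ax ya]; apply: (perp_sym (uvo_orthoframe hU)); exact: ya.
Qed.

(** From left to right, a successor of a point of [U] lies in the image of [U],
    hence in the bipolar of that image. Conversely, the set that separates
    [y] from the successors of [x] is [biexists] of a set around [x], which is
    exactly what the relation between the filters forbids. *)
Lemma point_filter_rel i x y :
  cs_rel i x y <-> cs_rel i (point_filter x) (point_filter y).
Proof.
split.
- move=> xy _ [a ax <-]; apply: (sub_polar2 (uvo_orthoframe hU)).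
  by exists x.
- move=> xy; apply: contrapT.
  move=> /(muvo_sep (cuvo_monadic hX i)) [_ [_ [V [BV Vx] ->]]]; apply.
  by apply: (xy (ca_exists i (exist _ V BV : A))); exists (exist _ V BV).
Qed.

End PointFilter.

Theorem theorem5p9 (I : Type) (X : cylindric_space I)
    (hX : is_cylindric_UVO X) :
  relationally_homeomorphic X (S0 (A0 hX)).
Proof.
have [g fK] := choice (point_filter_surj (hX := hX)).
exists (point_filter hX); split; last 2 first.
- exact: point_filter_perp.
- exact: point_filter_rel.
exists g; split=> //.
- by move=> x; apply: point_filter_inj; exact: fK.
- apply: continuous_phi => a; exact: (svalP a).1.2.
- apply: (continuous_basis (uvo_basis (cuvo_uvo hX))) => U BU.
  have -> : g @^-1` U = phi (exist _ U BU : A0 hX).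
    by apply/funext => F; rewrite -[in RHS](fK F).
  exact: phi_open.
Qed.
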